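(* Let $G$ be a finite simple graph with Kirchhoff Laplacian $K$, let $\zeta_G$ be its spectral zeta function and $r(G)$ its forest-tree ratio. Then $$r(G)=\exp\left(\sum_{s=1}^{\infty}(-1)^{s+1}\frac{\zeta_G(s)}{s}\right).$$
   Context: The Kirchhoff Laplacian of $G$ is $K=B-A$, with $B$ the diagonal vertex degree matrix and $A$ the adjacency matrix. The forest-tree ratio is $r(G)=\det(1+K)/\mathrm{Det}(K)=\prod_{\lambda\neq 0}\left(1+\frac1\lambda\right)$, the product over the nonzero eigenvalues $\lambda$ of $K$ counted with multiplicity, where $\mathrm{Det}(K)$ is the pseudo determinant (the product of the nonzero eigenvalues). The spectral zeta function is $\zeta_G(s)=\sum_{\lambda\ne 0}\lambda^{-s}$, the sum over the nonzero eigenvalues of $K$ with multiplicity.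
   Formalization: The identity is proved for exactly those graphs whose series converges, shown to be those with all nonzero eigenvalues of K at least 1; for others, such as the path on 4 vertices (eigenvalue 2−√2), the series diverges and the right-hand side is undefined. *)

(* Defs.v *)
From HB Require Import structures.
From mathcomp Require Import all_boot all_order all_algebra.
From mathcomp Require Import polyrcf.
From mathcomp Require Import all_classical all_reals all_analysis.
Import Order.TTheory GRing.Theory Num.Theory.
Import numFieldNormedType.Exports.

Set Implicit Arguments.
Unset Strict Implicit.
Unset Printing Implicit Defensive.

Local Open Scope classical_set_scope.
Local Open Scope ring_scope.

(* A finite simple graph is a finite type V of vertices (possibly empty) with
   an adjacency relation e; symmetry and irreflexivity of e are hypotheses of
   the results and not part of these definitions.  Matrices are indexed by
   'I_#|V| through the enumeration of V. *)
Section Graph.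
Variables (R : realType) (V : finType) (e : rel V).

Definition adjacency_mx : 'M[R]_#|V| :=
  \matrix_(i, j) (e (enum_val i) (enum_val j))%:R.

Definition degree_mx : 'M[R]_#|V| :=
  diag_mx (\row_i #|[set y | e (enum_val i) y]%SET|%:R).

Definition kirchhoff : 'M[R]_#|V| := degree_mx - adjacency_mx.

End Graph.

(* The real eigenvalues of A, each repeated according to its algebraic
   multiplicity (rootsR lists the distinct real roots of a polynomial).  For a
   symmetric A, such as the Kirchhoff Laplacian, these are all the
   eigenvalues. *)
Definition spectrum (R : realType) n (A : 'M[R]_n) : seq R :=
  flatten [seq nseq (mup x (char_poly A)) x | x <- rootsR (char_poly A)].

(* The product is 1 when A has no nonzero eigenvalue. *)
Definition pseudo_det (R : realType) n (A : 'M[R]_n) : R :=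
  \prod_(x <- spectrum A | x != 0) x.

Definition forest_tree_ratio (R : realType) (V : finType) (e : rel V) : R :=
  \det (1%:M + kirchhoff R e) / pseudo_det (kirchhoff R e).

Definition spectral_zeta (R : realType) (V : finType) (e : rel V) (s : R) : R :=
  \sum_(x <- spectrum (kirchhoff R e) | x != 0) x `^ (- s).

Definition zeta_partial_sum (R : realType) (V : finType) (e : rel V) : R^nat :=
  fun N => \sum_(1 <= s < N.+1)
    (-1) ^+ s.+1 * (spectral_zeta e s%:R / s%:R).

(* Main.v *)
Require Import Defs.
From HB Require Import structures.
From mathcomp Require Import all_boot all_order all_algebra.
From mathcomp Require Import complex polyrcf spectral.
From mathcomp Require Import all_classical all_reals all_analysis.
From mathcomp Require Import ring lra.
Import Order.TTheory GRing.Theory Num.Theory.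
Import numFieldNormedType.Exports.

(** A graph Laplacian K is real symmetric, so its characteristic polynomial
    splits over the reals and the spectrum lists all its roots; K is also
    positive semidefinite, so every nonzero eigenvalue x is positive
    ([char_poly_spectrum], [kirchhoff_eigenvalue_ge0]).  Evaluating the
    characteristic polynomial at -1 gives det (1 + K) as the product of the
    1 + x; the zero eigenvalues contribute 1 to it, and dividing by the pseudo
    determinant leaves the product of the 1 + 1/x ([forest_tree_ratioE]).

    Exchanging the two finite sums, the partial sums of the zeta series are
    sums over the nonzero eigenvalues of the partial sums of the Mercator series
    of ln (1 + y) at y = 1/x ([zeta_partial_sumE]).  The remainder of that series
    after N terms is at most y^(N+1)/(N+1) for every y >= 0, which tends to 0 on
    the whole of [0, 1], the endpoint y = 1 included.  Hence, when all nonzero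
    eigenvalues are at least 1, the series converges to the logarithm of the
    forest-tree ratio ([cvg_zeta_partial_sum]).

    Conversely an eigenvalue strictly between 0 and 1 has y > 1.  All the
    summands of zeta (s) are positive, so no cancellation between eigenvalues
    occurs in the s-th term of the series, whose absolute value is at least
    y^s/s >= y - 1; the terms do not tend to 0 and the series diverges
    ([cvgn_zeta_partial_sum_ge1]).  Convergence thus always forces the situation
    of the previous paragraph, and exponentiating gives the formula. *)

Set Implicit Arguments.
Unset Strict Implicit.
Unset Printing Implicit Defensive.

Local Open Scope classical_set_scope.
Local Open Scope ring_scope.

(** * Spectra of real symmetric matrices *)

Lemma char_poly_conj (F : comUnitRingType) n (P A : 'M[F]_n) :
  P \in unitmx -> char_poly (invmx P *m A *m P) = char_poly A.
Proof.
move=> Pu; rewrite /char_poly.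
have -> : char_poly_mx (invmx P *m A *m P) =
   map_mx polyC (invmx P) *m char_poly_mx A *m map_mx polyC P.
  rewrite /char_poly_mx !map_mxM mulmxBr mulmxBl; congr (_ - _).
  by rewrite scalar_mxC -mulmxA -map_mxM mulVmx// map_mx1 mulmx1.
rewrite !det_mulmx mulrAC -det_mulmx -map_mxM mulVmx// map_mx1 det1.
by rewrite mul1r.
Qed.

(** Over the complex extension R[i] the matrix becomes Hermitian, hence unitarily
    diagonalizable with real diagonal entries; the resulting factorization
    descends to R because {poly R} embeds in {poly R[i]}. *)
Lemma symmetric_char_poly_split (R : rcfType) n (A : 'M[R]_n) :
  A^T = A -> exists s : seq R, char_poly A = \prod_(x <- s) ('X - x%:P).
Proof.
move=> Asym; pose B := map_mx (real_complex R) A.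
have Bherm : B \is hermsymmx.
  apply: realsym_hermsym.
    by rewrite is_hermitianmxE expr0 scale1r map_mx_id// map_trmx Asym.
  by apply/mxOverP => i j; rewrite mxE complex_real.
have /orthomx_spectralP BE := hermitian_normalmx Bherm.
have /mxOverP dreal := hermitian_spectral_diag_real Bherm.
exists [seq complex.Re (spectral_diag B ord0 i) | i <- index_enum 'I_n].
apply: (map_poly_inj (real_complex R)).
rewrite map_char_poly map_prod_XsubC big_map -/B {1}BE.
rewrite char_poly_conj ?spectral_unit//.
rewrite char_poly_trig ?diag_mx_is_trig//; apply: eq_bigr => i _.
rewrite mxE eqxx mulr1n; congr ('X - _%:P).
by rewrite [RHS](RRe_real (dreal _ _)).
Qed.

Lemma count_mem_flatten_nseq (T : eqType) (f : T -> nat) (s : seq T) x :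
  uniq s ->
  count_mem x (flatten [seq nseq (f y) y | y <- s]) = ((x \in s) * f x)%N.
Proof.
elim: s => //= y s IHs /andP[ys us]; rewrite count_cat IHs// count_nseq in_cons.
have [->|] := eqVneq x y; first by rewrite /= (negbTE ys) eqxx addn0.
by rewrite eq_sym /= => /negbTE->.
Qed.

(** The spectrum collects only the real roots; for a symmetric matrix none is
    missing. *)
Lemma char_poly_spectrum (R : realType) n (A : 'M[R]_n) :
  A^T = A -> char_poly A = \prod_(x <- spectrum A) ('X - x%:P).
Proof.
move=> /symmetric_char_poly_split[s pE]; rewrite pE; apply: perm_big.
have p0 : char_poly A != 0 by rewrite monic_neq0// char_poly_monic.
apply/allP => x _ /=; apply/eqP; rewrite count_mem_flatten_nseq ?uniq_roots//.
rewrite -(roots_on_rootsR p0) in_itv /= -mu_prod_XsubC -pE.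
by have [_|/mupNroot->] := boolP (root _ _); rewrite ?mul1n.
Qed.

Lemma mem_spectrum (R : realType) n (A : 'M[R]_n) x :
  A^T = A -> (x \in spectrum A) = eigenvalue A x.
Proof.
move=> /char_poly_spectrum pE.
by rewrite eigenvalue_root_char pE root_prod_XsubC.
Qed.

(** Both sides are, up to the sign (-1)^n, the value at -1 of the characteristic
    polynomial. *)
Lemma det1D_spectrum (R : realType) n (A : 'M[R]_n) :
  A^T = A -> \det (1%:M + A) = \prod_(x <- spectrum A) (1 + x).
Proof.
move=> Asym; have pE := char_poly_spectrum Asym.
have sz : size (spectrum A) = n.
  by apply: succn_inj; rewrite -[LHS](size_prod_XsubC _ id) -pE size_char_poly.
have hE : (char_poly A).[-1] = (-1) ^+ n * \det (1%:M + A).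
  rewrite -[LHS]/(horner_eval (-1) _) -det_map_mx -detZ; congr (\det _).
  apply/matrixP => i j; rewrite !mxE /= /horner_eval !hornerE hornerMn hornerX.
  by ring.
apply: (mulfI (x := (-1) ^+ n)); first by rewrite signr_eq0.
rewrite -hE pE horner_prod -[X in (-1) ^+ X]sz.
elim: (spectrum A) => [|x s IHs]; first by rewrite !big_nil mulr1.
by rewrite !big_cons IHs !hornerE /= exprS; ring.
Qed.

(** * Positivity of the Kirchhoff Laplacian *)

Section Kirchhoff.
Variables (R : realType) (V : finType) (e : rel V).
Hypothesis e_sym : symmetric e.
Local Notation K := (kirchhoff R e).

Lemma trmx_kirchhoff : K^T = K.
Proof.
rewrite /kirchhoff linearB /= tr_diag_mx; congr (_ - _).
by apply/matrixP => i j; rewrite !mxE e_sym.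
Qed.

(** The Dirichlet form; the factor 1/2 appears because the double sum counts every
    edge in both directions. *)
Lemma kirchhoff_form (v : 'rV[R]_#|V|) :
  (v *m K *m v^T) 0 0 =
  2^-1 * \sum_i \sum_j adjacency_mx R e i j * (v 0 i - v 0 j) ^+ 2.
Proof.
have deg i : degree_mx R e i i = \sum_j adjacency_mx R e i j.
  rewrite !mxE eqxx mulr1n -sum1dep_card natr_sum.
  under [RHS]eq_bigr => j _ do rewrite mxE.
  rewrite -(big_enum_val (A := V) (fun y => (e (enum_val i) y)%:R)) /=.
  by rewrite big_mkcond; apply: eq_bigr => y _; case: ifP.
have KE i j : K i j = degree_mx R e i j - adjacency_mx R e i j.
  by rewrite [LHS]mxE [X in _ + X]mxE.
have symE : \sum_i \sum_j adjacency_mx R e i j * v 0 j ^+ 2 =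
            \sum_i \sum_j adjacency_mx R e i j * v 0 i ^+ 2.
  rewrite exchange_big /=; apply: eq_bigr => i _; apply: eq_bigr => j _.
  by rewrite !mxE e_sym.
(* The degree is a row sum of the adjacency matrix, which turns the diagonal part
   of K into a double sum as well. *)
transitivity (\sum_i \sum_j
    adjacency_mx R e i j * (v 0 i ^+ 2 - v 0 i * v 0 j)).
  rewrite mxE; under eq_bigr => j _ do rewrite mxE mxE.
  apply: eq_bigr => i _.
  under [RHS]eq_bigr => j _ do rewrite mulrBr.
  rewrite sumrB -mulr_suml -deg; under eq_bigr => j _ do rewrite KE mulrBr.
  rewrite sumrB mulrBl; congr (_ - _).
    rewrite (bigD1 i)//= big1 ?addr0 => [|j ji]; first by rewrite expr2; ring.
    by rewrite mxE (negbTE ji) mulr0.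
  by rewrite mulr_suml; apply: eq_bigr => j _; rewrite !mxE e_sym; ring.
rewrite [RHS]mulrC; apply/(canRL (mulfK _)); first by rewrite pnatr_eq0.
(* By symmetry, one of the two copies may carry the square of v j. *)
rewrite mulr_natr mulr2n; set S := (X in X + _).
transitivity (S + (\sum_i \sum_j adjacency_mx R e i j * v 0 j ^+ 2 -
                   \sum_i \sum_j adjacency_mx R e i j * (v 0 i * v 0 j))).
  rewrite symE -sumrB; congr (_ + _); rewrite /S; apply: eq_bigr => i _.
  by rewrite -sumrB; apply: eq_bigr => j _; ring.
rewrite -sumrB /S -big_split; apply: eq_bigr => i _ /=.
by rewrite -sumrB -big_split; apply: eq_bigr => j _ /=; ring.
Qed.

(** For an eigenvector v the Dirichlet form, a sum of squares, equals x |v|^2. *)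
Lemma kirchhoff_eigenvalue_ge0 x : eigenvalue K x -> 0 <= x.
Proof.
case/eigenvalueP => v vK v0.
have v2 : 0 < \sum_i v 0 i ^+ 2.
  rewrite lt_def sumr_ge0 ?andbT; last by move=> i _; exact: sqr_ge0.
  apply: contra_neq v0 => /eqP.
  rewrite psumr_eq0; last by move=> i _; exact: sqr_ge0.
  move=> /allP v0; apply/rowP => i; rewrite mxE; apply/eqP.
  by rewrite -sqrf_eq0; apply: v0; rewrite mem_index_enum.
rewrite -(pmulr_lge0 _ v2).
have <- : (v *m K *m v^T) 0 0 = x * \sum_i v 0 i ^+ 2.
  rewrite vK -scalemxAl mxE mxE; congr (_ * _).
  by apply: eq_bigr => i _; rewrite mxE.
rewrite kirchhoff_form mulr_ge0 ?invr_ge0//; apply: sumr_ge0 => i _.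
by apply: sumr_ge0 => j _; rewrite mulr_ge0 ?sqr_ge0// mxE ler0n.
Qed.

End Kirchhoff.

(** * The Mercator series of ln (1 + y) *)

Section LogSeries.
Variable R : realType.
Implicit Types y t : R.

Definition log_partial_sum t (N : nat) : R :=
  \sum_(1 <= s < N.+1) (-1) ^+ s.+1 * (t ^+ s / s%:R).

Lemma log_partial_sum0 N : log_partial_sum 0 N = 0.
Proof.
rewrite /log_partial_sum big_nat big1// => s /andP[s0 _].
by rewrite expr0n gtn_eqF// mul0r mulr0.
Qed.

(** The derivative of the N-th partial sum is a geometric sum of ratio -t, which
    differs from 1/(1 + t) by this single fraction. *)
Lemma is_derive_log_remainder N t : 0 <= t ->
  is_derive t 1 (fun u => ln (1 + u) - log_partial_sum u N)
    ((- t) ^+ N / (1 + t)).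
Proof.
move=> t0; have t1 : 0 < 1 + t by rewrite ltr_pwDl.
elim: N => [|N IHN].
  rewrite [X in is_derive _ _ X](_ : _ = @ln R \o shift 1); last first.
    by apply/funext => u; rewrite /log_partial_sum big_geq// subr0 addrC.
  rewrite expr0 mul1r -[X in is_derive _ _ _ X]mulr1 addrC.
  apply: is_derive1_comp; last exact: is_derive_shift.
  by apply: is_derive1_ln; rewrite /= addrC.
rewrite [X in is_derive _ _ X](_ : _ =
  (fun u => ln (1 + u) - log_partial_sum u N) -
  ((-1) ^+ N.+2 / N.+1%:R) \*: (@id R ^+ N.+1)); last first.
  apply/funext => u; rewrite /log_partial_sum big_nat_recr//= opprD addrA !fctE.
  by congr (_ - _); rewrite /= mulrCA mulrC.
have dX : is_derive t 1 (@id R ^+ N.+1) _ := is_deriveX N.+1 (is_derive_id t 1).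
apply: (is_derive_eq (is_deriveB IHN (is_deriveZ ((-1) ^+ N.+2 / N.+1%:R) dX))).
have N0 : N.+1%:R != 0 :> R by rewrite pnatr_eq0.
rewrite /= -[_ *: _]/(_ * (_ * 1)) mulr1 mulrA mulfVK// exprS -[- t]mulN1r.
by rewrite !exprMn !exprS; field; rewrite gt_eqF.
Qed.

(** On t >= 0 the derivative of the remainder is at most t^N in absolute value,
    and t^N is the derivative of the right-hand side; both sides vanish at 0, so
    the bound integrates from 0 to y. *)
Lemma ln1D_log_partial_sum y N : 0 <= y ->
  `|ln (1 + y) - log_partial_sum y N| <= y ^+ N.+1 / N.+1%:R.
Proof.
move=> y0; pose g u := ln (1 + u) - log_partial_sum u N.
have N0 : N.+1%:R != 0 :> R by rewrite pnatr_eq0.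
(* Adding c = 1 or c = -1 times the remainder to the bound gives a function that
   is nondecreasing on [0, y]. *)
suff bound (c : R) : `|c| = 1 -> 0 <= y ^+ N.+1 / N.+1%:R + c * g y.
  have := bound 1 (normr1 _); have := bound (-1) (normrN1 _).
  by rewrite -/(g y) ler_norml; set z := y ^+ _ / _; lra.
move=> c1; pose h := (N.+1%:R^-1 \*: (@id R ^+ N.+1)) + (c \*: g).
have dh t : 0 <= t -> is_derive t 1 h (t ^+ N + c * ((- t) ^+ N / (1 + t))).
  move=> t0; have := is_derive_log_remainder N t0 => dg.
  apply: is_derive_eq.
  by rewrite /= -[_ *: _]/(_ * (_ * 1)) mulr1 mulKf.
have hE u : h u = u ^+ N.+1 / N.+1%:R + c * g u.
  by rewrite /h !fctE /= mulrC.
have h0 : h 0 = 0.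
  by rewrite hE /g log_partial_sum0 addr0 ln1 subr0 mulr0 expr0n mul0r addr0.
rewrite -hE -h0; apply: (@ger0_derive1_ndecr _ h 0 y) => //.
- move=> t /[!in_itv]/= /andP[/ltW t0 _]; have := dh _ t0 => dht.
  exact: ex_derive.
- move=> t /[!in_itv]/= /andP[/ltW t0 _]; have := dh _ t0 => dht.
  rewrite derive1E derive_val -lerBlDl sub0r.
  apply: lerNnormlW; rewrite normrM c1 mul1r normrM normrX normrN.
  rewrite (ger0_norm t0); apply: ler_piMr; first exact: exprn_ge0.
  by rewrite normfV ger0_norm ?addr_ge0// invf_le1 ?lerDl// ltr_pwDl.
- apply: derivable_within_continuous => t /[!in_itv]/= /andP[t0 _].
  by have := dh _ t0 => dht; exact: ex_derive.
Qed.

(** The closed endpoint y = 1 matters: it is the case of an eigenvalue equal to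
    1, where the series converges only conditionally. *)
Lemma cvg_log_partial_sum y : 0 <= y <= 1 ->
  log_partial_sum y n @[n --> \oo] --> ln (1 + y).
Proof.
move=> /andP[y0 y1].
have : ln (1 + y) - log_partial_sum y n @[n --> \oo] --> (0 : R).
  apply: norm_cvg0; apply: (squeeze_cvgr _ (cvg_cst 0) cvg_harmonic).
  near=> n; rewrite normr_ge0/= (le_trans (ln1D_log_partial_sum _ y0))//.
  by rewrite /harmonic -[leRHS]mul1r ler_wpM2r ?invr_ge0// exprn_ile1.
move=> /(cvgB (cvg_cst (ln (1 + y)))); rewrite subr0.
by apply: cvg_trans; apply: near_eq_cvg; near=> n; rewrite !fctE subKr.
Unshelve. all: by end_near. Qed.

End LogSeries.

(** * The zeta series *)

Lemma bernoulli_ineq (R : realDomainType) (x : R) n :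
  0 <= x -> 1 + n%:R * x <= (1 + x) ^+ n.
Proof.
move=> x0; elim: n => [|n IHn]; first by rewrite mul0r addr0 expr0.
rewrite exprS -natr1; have : 0 <= n%:R * x ^+ 2 by rewrite mulr_ge0 ?sqr_ge0.
have := ler_wpM2l (ler_wpDl x0 (@ler01 R)) IHn.
by set z := _ ^+ n; nra.
Qed.

Section ZetaSeries.
Variables (R : realType) (V : finType) (e : rel V).
Hypothesis e_sym : symmetric e.
Local Notation K := (kirchhoff R e).

Lemma spectrum_kirchhoff_gt0 x : x \in spectrum K -> x != 0 -> 0 < x.
Proof.
rewrite mem_spectrum ?trmx_kirchhoff// => /(kirchhoff_eigenvalue_ge0 e_sym).
by move=> x0 xn0; rewrite lt_def xn0.
Qed.

Lemma spectral_zeta_natE (s : nat) :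
  spectral_zeta e s%:R = \sum_(x <- spectrum K | x != 0) x^-1 ^+ s.
Proof.
rewrite /spectral_zeta big_seq_cond [RHS]big_seq_cond.
apply: eq_bigr => x /andP[xK xn0].
by rewrite powR_invn ?exprVn// ltW// spectrum_kirchhoff_gt0.
Qed.

Lemma zeta_partial_sumE N : zeta_partial_sum R e N =
  \sum_(x <- spectrum K | x != 0) log_partial_sum x^-1 N.
Proof.
rewrite /log_partial_sum exchange_big /=; apply: eq_bigr => s _.
by rewrite spectral_zeta_natE mulr_suml mulr_sumr.
Qed.

(** The pseudo determinant skips the zero eigenvalues, and these contribute the
    factor 1 + 0 = 1 to det (1 + K). *)
Lemma forest_tree_ratioE :
  forest_tree_ratio R e = \prod_(x <- spectrum K | x != 0) (1 + x^-1).
Proof.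
rewrite /forest_tree_ratio det1D_spectrum ?trmx_kirchhoff// /pseudo_det.
rewrite (bigID (fun x => x != 0)) /= [X in _ * X / _]big1 ?mulr1; last first.
  by move=> x; rewrite negbK => /eqP->; rewrite addr0.
rewrite -prodf_div; apply: eq_bigr => x xn0.
by rewrite mulrDl mul1r divff// addrC.
Qed.

(** A finite sum of Mercator series, all evaluated inside ]0, 1]. *)
Lemma cvg_zeta_partial_sum :
  (forall x, x \in spectrum K -> x != 0 -> 1 <= x) ->
  zeta_partial_sum R e n @[n --> \oo] --> ln (forest_tree_ratio R e).
Proof.
move=> K1.
have -> : ln (forest_tree_ratio R e) =
    \sum_(x <- spectrum K | x != 0) ln (1 + x^-1).
  rewrite forest_tree_ratioE.
  rewrite big_seq_cond [RHS]big_seq_cond -[RHS]expRK; congr ln.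
  rewrite expR_sum; apply: eq_bigr => x /andP[xK xn0].
  by rewrite lnK// posrE addr_gt0// invr_gt0 spectrum_kirchhoff_gt0.
under eq_fun do rewrite zeta_partial_sumE big_seq_cond.
rewrite big_seq_cond; apply: cvg_big => [|x /andP[xK xn0]].
  exact: add_continuous.
apply: cvg_log_partial_sum; have x1 := K1 x xK xn0.
by rewrite invr_ge0 invf_le1 ?x1 ?(le_trans _ x1)// (lt_le_trans _ x1).
Qed.

(** An eigenvalue x < 1 keeps every term of the series at distance at least
    1/x - 1 from 0: writing 1/x = 1 + h, already (1 + h)^s / s >= h by Bernoulli,
    and the other eigenvalues only add to it. *)
Lemma cvgn_zeta_partial_sum_ge1 : cvgn (zeta_partial_sum R e) ->
  forall x, x \in spectrum K -> x != 0 -> 1 <= x.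
Proof.
move=> zcvg x xK xn0; rewrite leNgt; apply/negP => x1.
have x0 := spectrum_kirchhoff_gt0 xK xn0.
pose h := x^-1 - 1.
have h0 : 0 < h by rewrite subr_gt0 invf_gt1.
have term_ge N : h <= `|zeta_partial_sum R e N.+1 - zeta_partial_sum R e N|.
  rewrite /zeta_partial_sum big_nat_recr//= [X in `|X|]addrC addKr.
  rewrite normrM normrX normrN1 expr1n mul1r spectral_zeta_natE.
  rewrite ger0_norm; last first.
    rewrite divr_ge0// big_seq_cond sumr_ge0// => y /andP[yK yn0].
    by rewrite exprn_ge0// invr_ge0 ltW// spectrum_kirchhoff_gt0.
  rewrite ler_pdivlMr//.
  have /le_trans -> // : h * N.+1%:R <= x^-1 ^+ N.+1.
    have -> : x^-1 = 1 + h by rewrite /h addrC subrK.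
    apply: le_trans (bernoulli_ineq N.+1 (ltW h0)).
    by rewrite mulrC lerDr.
  rewrite (big_rem x)//= xn0 lerDl big_seq_cond sumr_ge0// => y /andP[yK yn0].
  by rewrite exprn_ge0// invr_ge0 ltW// spectrum_kirchhoff_gt0// (mem_rem yK).
have : `|zeta_partial_sum R e n.+1 - zeta_partial_sum R e n| @[n --> \oo]
    --> (0 : R).
  rewrite -(normr0 R) -(subrr (limn (zeta_partial_sum R e))).
  by apply: cvg_norm; apply: cvgB => //; rewrite cvg_shiftS.
move=> /(cvgr_lt _) /(_ _ h0)[N _ /(_ N (leqnn N))] /=.
by rewrite ltNge term_ge.
Qed.

End ZetaSeries.

Theorem lemma2 (R : realType) (V : finType) (e : rel V)
    (e_sym : symmetric e) (e_irr : irreflexive e) :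
  (cvgn (zeta_partial_sum R e) <->
     forall x : R, eigenvalue (kirchhoff R e) x -> x != 0 -> 1 <= x) /\
  (cvgn (zeta_partial_sum R e) ->
     forest_tree_ratio R e = expR (limn (zeta_partial_sum R e))).
Proof.
have specE x : (x \in spectrum (kirchhoff R e)) = eigenvalue (kirchhoff R e) x.
  by rewrite mem_spectrum ?trmx_kirchhoff.
split; first split.
- by move=> zcvg x; rewrite -specE; exact: cvgn_zeta_partial_sum_ge1.
- move=> K1; apply: (cvgP (ln (forest_tree_ratio R e))).
  by apply: cvg_zeta_partial_sum => // x; rewrite specE; exact: K1.
move=> /(cvgn_zeta_partial_sum_ge1 e_sym)/(cvg_zeta_partial_sum e_sym).
move=> /cvg_lim -> //.
rewrite lnK// posrE forest_tree_ratioE// big_seq_cond prodr_gt0// => x.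
move=> /andP[xK xn0].
by rewrite addr_gt0// invr_gt0 (spectrum_kirchhoff_gt0 e_sym).
Qed.
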